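(* Let $P\in\mathbb{C}[X,Y]$ be squarefree, written $P=\alpha_0(Y)X^d+\dots+\alpha_d(Y)$ with $\alpha_0\neq0$ and $d\ge1$, and let $\mathcal{C}=\{(x,y)\in\mathbb{C}^2: P(x,y)=0\}$. Let $\Delta\in\mathbb{C}[Y]$ be the discriminant of $P$ viewed as a polynomial in $X$, let $y_1,\dots,y_r$ be the distinct roots of $\Delta$, let $L_j\subset\mathbb{C}^2$ be the line of equation $Y=y_j$, and let $J=\{j\in\{1,\dots,r\}: L_j\nsubseteq\mathcal{C}\}$. Let $Q:=P\prod_{j\in J}(Y-y_j)$ and let $\nabla\in\mathbb{C}[X]$ be the discriminant of $Q$ viewed as a polynomial in $Y$ with coefficients in $\mathbb{C}[X]$. Choose $x_0\in\mathbb{C}$ which is not a root of $\nabla$, and let $S$ be the set of solutions in $Y$ of $Q(x_0,Y)=0$. Then $y_j\in S$ for all $j\in\{1,\dots,r\}$. Moreover, choose $y_0\in\mathbb{C}-S$ and, for each $j\in\{1,\dots,r\}$, a loop $\gamma_j$ in $\mathbb{C}-S$ based at $y_0$ representing a meridian of $S$ around $y_j$. Then, for all $j$, the path $\tilde\gamma_j:=(x_0,\gamma_j)$, i.e. $t\mapsto(x_0,\gamma_j(t))$, represents a meridian of $\mathcal{C}\cup L_1\cup\dots\cup L_r$ around $L_j$.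
   Context: The discriminant of a polynomial $A$ of degree $n\ge1$ in a variable $T$ (with coefficients in a polynomial ring) means here the resultant of $A$ and $\partial A/\partial T$ with respect to $T$ (formal degrees $n$ and $n-1$); for $n=0$ it is taken to be $1$. In particular $\Delta(y)\ne0$ if and only if $P(X,y)$ has exactly $d$ distinct roots. Meridians. Let $\mathcal{H}$ be an algebraic hypersurface in $\mathbb{C}^m$ (for $m=1$: a finite set of points) and let $b$ be a basepoint in its complement. Given a smooth point $z\in\mathcal{H}$ and a path from $b$ to $z$ meeting $\mathcal{H}$ only at its endpoint $z$, the associated meridian is the element of $\pi_1(\mathbb{C}^m-\mathcal{H},b)$ represented by: follow the path until just before $z$, make one positive full turn around $\mathcal{H}$ near $z$ (positive for the standard orientation of $\mathbb{C}$), and return along the path. It is called a meridian of $\mathcal{H}$ around $D$, where $D$ is the unique irreducible component of $\mathcal{H}$ containing $z$. *)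

(* Defs.v *)
From HB Require Import structures.
From mathcomp Require Import all_boot all_order all_algebra.
From mathcomp Require Import polyXY complex.
From mathcomp Require Import all_classical all_reals all_analysis.
(* The notations of mpoly clash with those of mathcomp-analysis. *)
From mathcomp Require Import -(notations) mpoly.

Set Implicit Arguments.
Unset Strict Implicit.
Unset Printing Implicit Defensive.

Import Order.TTheory GRing.Theory Num.Theory.
Import numFieldNormedType.Exports.

Local Open Scope classical_set_scope.
Local Open Scope ring_scope.
Local Open Scope complex_scope.

(* The topology of the modulus on R[i]; C-normed spaces are normed modules over
   R[i], so that [differentiable] below means complex differentiable. *)
HB.instance Definition _ (R : rcfType) := NormedModule.copy R[i] R[i]^o.

(* In characteristic 0, p^`() has degree exactly one less than p, so that the
   actual degrees used by [resultant] are the formal degrees n and n - 1. *)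
Definition discriminant (A : comNzRingType) (p : {poly A}) : A :=
  if (size p <= 1)%N then 1 else resultant p p^`().

Definition squarefree (A : comUnitRingType) (a : A) : Prop :=
  a <> 0 /\ forall b c : A, a = b ^+ 2 * c -> b \is a GRing.unit.

Section AlgebraicSets.
Variables (R : realType) (m : nat).
Local Notation C := R[i].
Implicit Types (V D E H : set 'rV[C]_m) (z : 'rV[C]_m).

Definition eval_at (f : mpoly m C) z : C := meval (z 0) f.

Definition zero_locus (I : set (mpoly m C)) : set 'rV[C]_m :=
  [set z | forall f, I f -> eval_at f z = 0].

Definition algebraic V : Prop := exists I, V = zero_locus I.

Definition hypersurface H : Prop :=
  exists2 f : mpoly m C, f <> 0 & H = zero_locus [set f].

Definition irreducible_set V : Prop :=
  [/\ algebraic V, V !=set0 &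
    forall V1 V2, algebraic V1 -> algebraic V2 ->
      V `<=` V1 `|` V2 -> V `<=` V1 \/ V `<=` V2].

Definition irreducible_component H D : Prop :=
  [/\ irreducible_set D, D `<=` H &
    forall E, irreducible_set E -> E `<=` H -> D `<=` E -> E = D].

(* Jacobian criterion in codimension 1: some polynomial of the vanishing ideal
   of H has a nonzero gradient at z. *)
Definition smooth_point H z : Prop :=
  H z /\ exists f : mpoly m C,
    (forall w, H w -> eval_at f w = 0) /\
    (exists k : 'I_m, eval_at (mderiv k f) z <> 0).

End AlgebraicSets.

Section Paths.
Variables (R : realType) (T : topologicalType).
Implicit Types (A : set T) (f g : R -> T).

(* Paths are parametrized by the segment [0, 1] of R; the values of the
   functions outside this segment are irrelevant. *)
Definition path_continuous f : Prop := {within `[0, 1], continuous f}.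

Definition loop_in A (b : T) f : Prop :=
  [/\ path_continuous f, f 0 = b, f 1 = b & forall t : R, t \in `[0, 1] -> A (f t)].

(* Homotopy in A with fixed endpoints. *)
Definition path_homotopic A f g : Prop :=
  exists h : R * R -> T,
  [/\ {within `[0, 1] `*` `[0, 1], continuous h},
      forall s t : R, s \in `[0, 1] -> t \in `[0, 1] -> A (h (s, t)),
      forall t : R, t \in `[0, 1] -> h (0, t) = f t /\ h (1, t) = g t &
      forall s : R, s \in `[0, 1] -> h (s, 0) = f 0 /\ h (s, 1) = f 1].

Definition path_cat f g : R -> T :=
  fun t => if t <= 2^-1 then f (2 * t) else g (2 * t - 1).

Definition path_rev f : R -> T := fun t => f (1 - t).

Definition path_upto f (s : R) : R -> T := fun t => f (s * t).

End Paths.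

Section Meridians.
Variables (R : realType) (m : nat).
Local Notation C := R[i].
Implicit Types (H D U : set 'rV[C]_m) (z b : 'rV[C]_m).
Implicit Types (phi psi : 'rV[C]_m -> 'rV[C]_m) (k : 'I_m).

Definition polydisc : set 'rV[C]_m := [set w | forall l, `|w 0 l| < 1].

(* phi : U -> polydisc is a biholomorphism with inverse psi, i.e. a system of
   holomorphic coordinates at z, in which H is the hyperplane w_k = 0. *)
Definition straightening H z U phi psi k : Prop :=
  [/\ open U, U z & phi z = 0] /\
  [/\ forall w, U w -> polydisc (phi w), forall w, polydisc w -> U (psi w),
      forall w, U w -> psi (phi w) = w & forall w, polydisc w -> phi (psi w) = w] /\
  [/\ forall w, U w -> differentiable phi w,
      forall w, polydisc w -> differentiable psi w &
      forall w, U w -> (H w <-> phi w 0 k = 0)].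

(* The angle t of a turn is measured in full turns: t |-> exp(2 i pi t). *)
Definition unit_circle (t : R) : C :=
  cos (2 * pi * t) +i* sin (2 * pi * t).

(* One positive turn around H = {w_k = 0}, starting from w. *)
Definition positive_turn phi psi k (w : 'rV[C]_m) : R -> 'rV[C]_m :=
  fun t => psi (\row_l (if l == k then unit_circle t * phi w 0 l
                        else phi w 0 l)).

(* The loop gamma represents a meridian of H around D based at b. The turn is
   made at p s, just before z: the end of the path, from time s on, stays in
   the domain of the coordinates. *)
Definition is_meridian H D b (gamma : R -> 'rV[C]_m) : Prop :=
  [/\ hypersurface H, ~ H b, loop_in (~` H) b gamma &
  exists z (p : R -> 'rV[C]_m),
    [/\ smooth_point H z,
        unique (fun E => irreducible_component H E /\ E z) D,
        [/\ path_continuous p, p 0 = b, p 1 = z &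
            forall t : R, t \in `[0, 1[ -> ~ H (p t)] &
    exists U phi psi k s,
      [/\ straightening H z U phi psi k,
          s \in `[0, 1[,
          forall t : R, t \in `[s, 1] -> U (p t) &
          path_homotopic (~` H) gamma
            (path_cat
               (path_cat (path_upto p s) (positive_turn phi psi k (p s)))
               (path_rev (path_upto p s)))]]].

End Meridians.

Section PlaneCurves.
Variable R : realType.
Local Notation C := R[i].

(* The affine line C is identified with 'rV[C]_1. *)
Definition pt1 (y : C) : 'rV[C]_1 := const_mx y.

Definition pt2 (x y : C) : 'rV[C]_2 :=
  \row_(l < 2) (if l == 0 then x else y).

(* An element of C[X, Y] is seen in C[Y][X]: the outer variable is X, and
   P.[x, y] is P(x, y). *)
Definition plane_curve (P : {poly {poly C}}) : set 'rV[C]_2 :=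
  [set z | P.[z 0 0, z 0 1] = 0].

Definition hline (b : C) : set 'rV[C]_2 := [set z | z 0 1 = b].

End PlaneCurves.

(* Main.v *)
Require Import Defs.
From mathcomp Require Import all_boot all_order all_algebra.
From mathcomp Require Import polyXY complex.
From mathcomp Require Import all_classical all_reals all_analysis.
From mathcomp Require Import -(notations) mpoly.
From mathcomp Require Import zify ring lra.
Set Implicit Arguments.
Unset Strict Implicit.
Unset Printing Implicit Defensive.
Import Order.TTheory GRing.Theory Num.Theory.
Import numFieldNormedType.Exports.
Local Open Scope classical_set_scope.
Local Open Scope ring_scope.
Local Open Scope complex_scope.

(** Write [H] for the union of the curve and the lines [L_k], and [b] for [y_j].
    A line [L_k] with [k] outside [J] lies on the curve, so [H] is the zero set
    of [Q], and the vertical line [X = x0] meets [H] exactly above [S].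
    As [Q] vanishes on [L_j], it factors as [q * (Y - b)].  If [q] vanished at
    [(x0, b)], then [b] would be a common root of [Q(x0, Y)] and of its
    derivative, and the Sylvester matrix, evaluated at [x0], would kill the
    vector of powers of [b]; the discriminant would vanish at [x0].  Hence [q]
    does not vanish near [(x0, b)], and there [H] is just the line [L_j]
    ([discriminant_simple_root], [line_factor]).  This makes [(x0, b)] a smooth
    point of [H] and [L_j] the only irreducible component through it
    ([smooth_point_simple_root], [component_of_simple_root]).

    Holomorphic coordinates for [H] at [(x0, b)] are the product of a rescaled
    [X - x0] with the given coordinate [phi] around [b] in the line
    ([prod_straightening]).  The factor [q] may vanish at points of
    [D x U], for any small disc [D] around [x0], so that the domain of [phi]
    must first be shrunk to a disc [|phi| < rho] ([product_chart_domain]).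
    The end of the path [p] after time [s] need not stay in the smaller domain,
    but its end after some later time [s'] does.  The lassos that turn around
    [b] at time [s] and at time [s'] are homotopic in the complement of [S],
    since one may turn at any intermediate time ([lasso_homotopic],
    [turn_lassos_homotopic]).  Transporting the homotopies by the embedding
    [c |-> (x0, c)], which maps the complement of [S] to that of [H] and a turn
    for [phi] to a turn for the product coordinates, gives the meridian
    ([meridian_vertical]). *)

(** * Simple roots and non-vanishing discriminants *)

Section SimpleRoots.

(** The vector of powers of [b] is in the kernel of the image under [f] of the
    Sylvester matrix: its rows are the coefficients of multiples of [p] and
    [q].  This is uniform in the degree of [q], which is [0] when [q] is the
    derivative of a polynomial of degree [1]. *)
Lemma resultant_common_root (A : comNzRingType) (K : idomainType)
    (f : {rmorphism A -> K}) (p q : {poly A}) (b : K) :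
  (1 < size p)%N -> root (map_poly f p) b -> root (map_poly f q) b ->
  f (resultant p q) = 0.
Proof.
move=> p_gt1 /rootP pb /rootP qb.
rewrite /resultant -det_map_mx -det_tr; apply/eqP/det0P.
exists (\row_j b ^+ j).
  have dS_gt0 : (0 < (size q).-1 + (size p).-1)%N.
    by rewrite addn_gt0 -[X in _ || X]ltnS prednK ?p_gt1 ?orbT // ltnW.
  apply/eqP => /rowP /(_ (Ordinal dS_gt0)); rewrite !mxE expr0.
  by apply/eqP; exact: oner_neq0.
apply/rowP => i; rewrite !mxE.
(* A row of the Sylvester matrix lists the coefficients of r * 'X^k. *)
have rowE (r : {poly A}) k : root (map_poly f r) b ->
    (size r + k <= (size q).-1 + (size p).-1)%N ->
    \sum_(j < (size q).-1 + (size p).-1) b ^+ j * f (r`_(j - k) *+ (k <= j)) = 0.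
  move=> /rootP rb le_rk.
  transitivity (map_poly f (r * 'X^k)).[b]; last first.
    by rewrite rmorphM hornerM rb mul0r.
  rewrite (@horner_coef_wide _ ((size q).-1 + (size p).-1)); last first.
    apply: leq_trans (size_poly _ _) _; apply: leq_trans (size_polyMleq _ _) _.
    by rewrite size_polyXn addnS.
  apply: eq_bigr => j _; rewrite mulrC coef_map coefMXn; congr (f _ * _).
  by rewrite ltnNge; case: (k <= j)%N.
under eq_bigr do rewrite mxE [X in _ * X]mxE [X in _ * X]mxE Sylvester_mxE.
case: (fintype.split i) => k; apply: rowE; rewrite /root ?pb ?qb //;
  have := ltn_ord k; set m := size p in p_gt1 *; set n := size q; lia.
Qed.

Lemma discriminant_simple_root (K : idomainType) (q q1 : {poly {poly K}})
    (x b : K) :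
  (1 < size q)%N -> q = q1 * ('X - b%:P%:P) ->
  ~ root (discriminant q) x -> q1.[b%:P].[x] != 0.
Proof.
move=> q_gt1 qE; rewrite /discriminant leqNgt q_gt1 /= => disc0.
apply/negP => /eqP q1b; apply: disc0; rewrite /root; apply/eqP.
have evE (p : {poly {poly K}}) : (map_poly (horner_eval x) p).[b] = p.[b%:P].[x].
  have := horner_map (horner_eval x) p b%:P.
  by rewrite /= /horner_eval hornerC.
apply: (@resultant_common_root _ _ (horner_eval x) q q^`() b) => //.
  by rewrite /root evE qE hornerM hornerXsubC subrr mulr0 horner0.
rewrite /root evE qE derivM derivXsubC mulr1 hornerD hornerM hornerXsubC subrr.
by rewrite mulr0 add0r q1b.
Qed.

Lemma poly_eq0_horner (K : numDomainType) (p : {poly K}) :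
  (forall x, p.[x] = 0) -> p = 0.
Proof.
move=> p0; apply: (@roots_geq_poly_eq0 _ _ [seq k%:R | k <- iota 0 (size p)]).
- by apply/allP => x _; rewrite /root p0.
- by rewrite map_inj_uniq ?iota_uniq // => m n /eqP; rewrite eqr_nat => /eqP.
by rewrite size_map size_iota.
Qed.

Lemma line_factor (K : numDomainType) (q : {poly {poly K}}) (b : K) :
  (forall x, q.[x, b] = 0) -> exists q1, swapXY q = q1 * ('X - b%:P%:P).
Proof.
move=> qb0; apply/factor_theorem; rewrite /root; apply/eqP.
by apply: poly_eq0_horner => x; rewrite horner2_swapXY.
Qed.

End SimpleRoots.

(** * Hypersurfaces of the plane near a simple root *)

Section PlaneHypersurfaces.
Variable R : realType.
Local Notation C := R[i].

Definition mpoly2 (q : {poly {poly C}}) : mpoly 2 C :=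
  (map_poly (horner_eval (mpolyX C (mnm1 1)) \o map_poly (@mpolyC 2 C)) q)
    .[mpolyX C (mnm1 0)].

Lemma eval_mpoly2 q z : eval_at (mpoly2 q) z = q.[z 0 0, z 0 1].
Proof.
rewrite /eval_at /mpoly2 -horner_map -map_poly_comp /= mevalXU.
rewrite -[RHS](@horner_map _ _ (horner_eval (z 0 1))) /= /horner_eval hornerC.
congr (_.[_]); apply: eq_map_poly => p /=.
rewrite /horner_eval -horner_map -map_poly_comp /= mevalXU.
congr (_.[_]); apply: map_poly_id => c _ /=; exact: mevalC.
Qed.

Lemma pt2_0 (x c : C) : pt2 x c 0 0 = x.
Proof. by rewrite mxE. Qed.

Lemma pt2_1 (x c : C) : pt2 x c 0 1 = c.
Proof. by rewrite mxE. Qed.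

Lemma pt2E (z : 'rV[C]_2) : pt2 (z 0 0) (z 0 1) = z.
Proof.
apply/rowP => l; rewrite mxE; case: eqP => [->//|l0]; congr (z _ _).
by apply/val_inj; case: l l0 => [[|[|]]] //= ? /eqP.
Qed.

Lemma restrict_line (f : mpoly 2 C) (b : C) :
  exists g : {poly C}, forall x, eval_at f (pt2 x b) = g.[x].
Proof.
exists (mmap (@polyC C) (fun k : 'I_2 => if k == 0 then 'X else b%:P) f) => x.
rewrite /eval_at mevalE /mmap horner_sum; apply: eq_bigr => m _.
rewrite hornerM hornerC /mmap1 horner_prod; congr (_ * _).
apply: eq_bigr => k _; rewrite horner_exp mxE.
by case: ifP => _; rewrite ?hornerX ?hornerC.
Qed.

Lemma zero_locus_mpoly2 (q : {poly {poly C}}) :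
  zero_locus [set mpoly2 q] = [set z | q.[z 0 0, z 0 1] = 0].
Proof.
apply/seteqP; split=> z /=; first by move/(_ _ erefl); rewrite eval_mpoly2.
by move=> qz _ ->; rewrite eval_mpoly2.
Qed.

Lemma horner2_XsubC (b x c : C) : ('Y - b%:P%:P).[x, c] = c - b.
Proof. by rewrite !hornerE. Qed.

(** Polynomials restricted to the line are polynomials in [x]: if one of them
    is nonzero in each of two ideals, their product is a nonzero polynomial,
    whose zeros are not all of the line. *)
Lemma irreducible_hline (b : C) : irreducible_set (@hline R b).
Proof.
split.
- exists [set mpoly2 ('Y - b%:P%:P)]; rewrite zero_locus_mpoly2.
  apply/seteqP; split=> z /=; rewrite horner2_XsubC => /eqP.
    by rewrite -subr_eq0 => /eqP.
  by rewrite subr_eq0 => /eqP.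
- by exists (pt2 0 b); rewrite /hline /= pt2_1.
move=> _ _ [I1 ->] [I2 ->] bI; apply: contrapT => /not_orP [/existsNP[z1 nz1]].
case/existsNP=> z2 nz2.
have vanish I z : ~ (hline b z -> zero_locus I z) ->
    exists2 g : {poly C}, g != 0 &
      forall x, zero_locus I (pt2 x b) -> g.[x] = 0.
  move=> /not_implyP[zb /existsNP[f /not_implyP[If fz]]].
  have [g fg] := restrict_line f b; exists g => [|x /(_ _ If)]; last first.
    by rewrite fg.
  apply: contra_notN fz => /eqP g0; rewrite -(pt2E z) (_ : z 0 1 = b) //.
  by rewrite fg g0 horner0.
have [g1 g1_neq0 g1I] := vanish _ _ nz1; have [g2 g2_neq0 g2I] := vanish _ _ nz2.
have /eqP : g1 * g2 = 0.
  apply: poly_eq0_horner => x; rewrite hornerM.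
  have /bI[/g1I->|/g2I->] : hline b (pt2 x b) by rewrite /hline /= pt2_1.
    by rewrite mul0r.
  by rewrite mulr0.
by rewrite mulf_eq0 (negPf g1_neq0) (negPf g2_neq0).
Qed.

(** An irreducible subset of the hypersurface lies on the line or on the curve
    [q1 = 0], and the latter avoids the point. *)
Lemma component_of_simple_root (q1 : {poly {poly C}}) (b x : C) :
    q1.[x, b] != 0 ->
  unique (fun E => irreducible_component
      [set z : 'rV[C]_2 | q1.[z 0 0, z 0 1] * (z 0 1 - b) = 0] E /\
      E (pt2 x b)) (hline b).
Proof.
move=> q1x; set H := [set _ | _].
have bH : hline b `<=` H.
  by move=> z; rewrite /H /hline /= => ->; rewrite subrr mulr0.
have sub_line E : irreducible_set E -> E `<=` H -> E (pt2 x b) ->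
    E `<=` hline b.
  move=> [_ _ irrE] EH Ex.
  have [|||//|/(_ _ Ex)] := irrE (hline b) [set z | q1.[z 0 0, z 0 1] = 0].
  - by have [] := irreducible_hline b.
  - by exists [set mpoly2 q1]; rewrite zero_locus_mpoly2.
  - move=> z /EH /= /eqP; rewrite mulf_eq0 subr_eq0.
    by case/orP => /eqP; [right|left].
  by rewrite /= pt2_0 pt2_1 => /eqP; rewrite (negPf q1x).
have xb : hline b (pt2 x b) by rewrite /hline /= pt2_1.
split=> [|E [[irrE EH maxE] Ex]].
  split=> //; split=> [||E irrE EH bE]; [exact: irreducible_hline|exact: bH|].
  by apply/seteqP; split=> //; apply: sub_line => //; apply: bE.
apply: maxE => //; first exact: irreducible_hline.
exact: sub_line.
Qed.

(** By the product rule, the derivative in [y] of the defining equation is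
    [q1] at the point. *)
Lemma smooth_point_simple_root (q1 : {poly {poly C}}) (b x : C) :
    q1.[x, b] != 0 ->
  smooth_point [set z : 'rV[C]_2 | q1.[z 0 0, z 0 1] * (z 0 1 - b) = 0]
    (pt2 x b).
Proof.
move=> q1x; split; first by rewrite /= pt2_1 subrr mulr0.
pose l : mpoly 2 C := mpolyX C (mnm1 1) - mpolyC 2 b.
have lE z : eval_at l z = z 0 1 - b by rewrite /eval_at mevalB mevalXU mevalC.
exists (mpoly2 q1 * l); split=> [w /= <-|].
  by rewrite /eval_at mevalM -!/(eval_at _ _) eval_mpoly2 lE.
exists 1; rewrite mderivM /eval_at mevalD !mevalM -!/(eval_at _ _) lE eval_mpoly2.
rewrite pt2_0 pt2_1 subrr mulr0 add0r mderivB mderivC mderivX.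
rewrite mnm1E eqxx scale1r subr0 (_ : mnm_sub _ _ = mnm0); last first.
  by apply/mnmP => k; rewrite mnmBE subnn mnm0E.
by rewrite mpolyX0 /eval_at meval1 mulr1; apply/eqP.
Qed.

End PlaneHypersurfaces.

(** * Homotopies of paths *)

Section ContinuityWithin.
Variables (X Y Z : topologicalType).

Lemma within_continuous_comp_within (A : set X) (B : set Y)
    (f : X -> Y) (g : Y -> Z) :
  {within A, continuous f} -> {within B, continuous g} ->
  (forall x, A x -> B (f x)) -> {within A, continuous (g \o f)}.
Proof.
move=> /subspace_continuousP cf /subspace_continuousP cg AB.
apply/subspace_continuousP => x Ax W Wgf.
have gW : nbhs (f x) [set y | B y -> W (g y)] by exact: cg (AB _ Ax) _ Wgf.
have := cf x Ax _ gW; rewrite /nbhs /= /within /=.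
by apply: filterS => x' h Ax'; apply: h => //; exact: AB.
Qed.

Lemma within_continuous_pair (A : set X) (f : X -> Y) (g : X -> Z) :
  {within A, continuous f} -> {within A, continuous g} ->
  {within A, continuous (fun x => (f x, g x))}.
Proof.
move=> /subspace_continuousP cf /subspace_continuousP cg.
by apply/subspace_continuousP => x Ax; exact: (cvg_pair (cf x Ax) (cg x Ax)).
Qed.

Lemma continuous_pair (f : X -> Y) (g : X -> Z) :
  continuous f -> continuous g -> continuous (fun x => (f x, g x)).
Proof. by move=> cf cg x; exact: (cvg_pair (cf x) (cg x)). Qed.

Lemma closed_setX (A : set X) (B : set Y) :
  closed A -> closed B -> closed (A `*` B).
Proof.
move=> cA cB.
have -> : A `*` B = fst @^-1` A `&` snd @^-1` B by apply/seteqP; split.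
by apply: closedI; apply: preimage_closed => // z _;
  [exact: cvg_fst|exact: cvg_snd].
Qed.

End ContinuityWithin.

Section Homotopies.
Variables (R : realType) (T : topologicalType).
Implicit Types (F G : R * R -> T) (f g h : R -> T) (A : set T).

Local Notation I := (`[0, 1]%classic : set R).

(** The parameter of the families is the first coordinate, the time is the
    second one.  The concatenation is glued from its restrictions to the closed
    halves of the square; these agree on the common side,
    as the first path of each pair ends where the second starts. *)
Lemma path_cat_family F G :
  {within I `*` I, continuous F} -> {within I `*` I, continuous G} ->
  (forall s, s \in `[0, 1] -> F (s, 1) = G (s, 0)) ->
  {within I `*` I, continuous (fun st =>
    path_cat (fun t => F (st.1, t)) (fun t => G (st.1, t)) st.2)}.
Proof.
move=> cF cG FG.
have -> : I `*` I = I `*` `[0, 2^-1]%classic `|` I `*` `[2^-1, 1]%classic.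
  apply/seteqP; split=> -[s t] /=; rewrite !in_itv /=.
    by move=> [? /andP[? ?]]; case: (leP t 2^-1) => ?; [left|right]; split=> //; lra.
  by move=> [[? /andP[? ?]]|[? /andP[? ?]]]; split=> //; lra.
apply: withinU_continuous.
- by apply: closed_setX; exact: itv_closed.
- by apply: closed_setX; exact: itv_closed.
- apply: (@subspace_eq_continuous _ _ _ (F \o fun st : R * R => (st.1, 2 * st.2))).
    move=> [s t]; rewrite inE /= !in_itv /= => -[_ /andP[_ t2]].
    by rewrite [RHS]/path_cat [X in if X then _ else _]t2.
  apply: within_continuous_comp_within _ cF _ => [|[s t]]; last first.
    by rewrite /= !in_itv /= => -[-> /andP[? ?]]; split=> //; lra.
  apply: continuous_subspaceT; apply: continuous_pair => st; first exact: cvg_fst.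
  by apply: cvgM; [exact: cvg_cst|exact: cvg_snd].
apply: (@subspace_eq_continuous _ _ _ (G \o fun st : R * R => (st.1, 2 * st.2 - 1))).
  move=> [s t]; rewrite inE /= !in_itv /= => -[sI /andP[t2 _]].
  rewrite [RHS]/path_cat; case: ifP => // t2'.
  have -> : t = 2^-1 by apply/eqP; rewrite eq_le t2 t2'.
  by rewrite divff // subrr FG.
apply: within_continuous_comp_within _ cG _ => [|[s t]]; last first.
  by rewrite /= !in_itv /= => -[-> /andP[? ?]]; split=> //; lra.
apply: continuous_subspaceT; apply: continuous_pair => st; first exact: cvg_fst.
apply: cvgB; last exact: cvg_cst.
by apply: cvgM; [exact: cvg_cst|exact: cvg_snd].
Qed.

Lemma path_cat_in A f g :
  (forall t : R, t \in `[0, 1] -> A (f t)) ->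
  (forall t : R, t \in `[0, 1] -> A (g t)) ->
  forall t : R, t \in `[0, 1] -> A (path_cat f g t).
Proof.
move=> fA gA t; rewrite in_itv /= => /andP[t0 t1]; rewrite /path_cat.
by case: leP => t2; [apply: fA|apply: gA]; rewrite in_itv /=; lra.
Qed.

Lemma path_cat0 f g : path_cat f g 0 = f 0.
Proof. by rewrite /path_cat invr_ge0 ler0n mulr0. Qed.

Lemma path_cat1 f g : path_cat f g 1 = g 1.
Proof.
rewrite /path_cat (_ : (1 <= 2^-1 :> R) = false); last by apply/negbTE; lra.
by congr g; lra.
Qed.

Lemma path_homotopic_trans A f g h :
  path_homotopic A f g -> path_homotopic A g h -> path_homotopic A f h.
Proof.
move=> [H [cH HA Hfg H01]] [K [cK KA Kgh K01]].
have I0 : (0 : R) \in `[0, 1] by rewrite in_itv /=; lra.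
have I1 : (1 : R) \in `[0, 1] by rewrite in_itv /=; lra.
have gf0 : g 0 = f 0 by have [<- _] := H01 _ I1; have [_ ->] := Hfg _ I0.
have gf1 : g 1 = f 1 by have [_ <-] := H01 _ I1; have [_ ->] := Hfg _ I1.
exists (fun st => path_cat (fun s => H (s, st.2)) (fun s => K (s, st.2)) st.1).
(* path_cat_family concatenates along the second coordinate, whereas the
   parameter of a homotopy is the first one. *)
have swapC : {within I `*` I, continuous (fun ts : R * R => (ts.2, ts.1))}.
  by apply: continuous_subspaceT; apply: continuous_pair => st;
    [exact: cvg_snd|exact: cvg_fst].
split.
- pose cat_HK (st : R * R) := path_cat (fun t => H (t, st.1))
    (fun t => K (t, st.1)) st.2.
  have cHK : {within I `*` I, continuous cat_HK}.
    apply: (path_cat_family (F := fun ts => H (ts.2, ts.1))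
      (G := fun ts => K (ts.2, ts.1))) => [||s sI].
    + by apply: within_continuous_comp_within swapC cH _ => // -[? ?] [].
    + by apply: within_continuous_comp_within swapC cK _ => // -[? ?] [].
    by rewrite /=; have [_ ->] := Hfg _ sI; have [-> _] := Kgh _ sI.
  by have := within_continuous_comp_within swapC cHK; apply=> -[? ?] [].
- by move=> s t sI tI; apply: path_cat_in => // u uI /=; [apply: HA|apply: KA].
- move=> t tI; rewrite path_cat0 path_cat1 /=.
  by have [-> _] := Hfg _ tI; have [_ ->] := Kgh _ tI.
move=> s; rewrite in_itv /= => /andP[s0 s1]; rewrite /path_cat /=.
case: leP => s2.
  by apply: H01; rewrite in_itv /=; lra.
by rewrite -gf0 -gf1; apply: K01; rewrite in_itv /=; lra.
Qed.

End Homotopies.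

Section HomotopyImage.
Variables (R : realType) (T T' : topologicalType).

Lemma path_homotopic_image (A : set T) (B : set T') (phi : T -> T') f g :
  continuous phi -> (forall x, A x -> B (phi x)) ->
  @path_homotopic R T A f g -> path_homotopic B (phi \o f) (phi \o g).
Proof.
move=> cphi AB [h [ch hA hfg h01]]; exists (phi \o h); split.
- by apply: within_continuous_comp ch => x _; exact: cphi.
- by move=> s t sI tI; apply: AB; exact: hA.
- by move=> t /hfg[/= -> ->].
by move=> s /h01[/= -> ->].
Qed.

End HomotopyImage.

Section Lassos.
Variables (R : realType) (T : topologicalType).
Local Notation I := (`[0, 1]%classic : set R).

(** The turn is a family of loops, indexed by the time at which it is made. *)
Definition lasso (p : R -> T) (turn : R -> R -> T) (s : R) : R -> T :=
  path_cat (path_cat (path_upto p s) (turn s)) (path_rev (path_upto p s)).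

(** The lassos that turn at the times between [a] and [b] form the homotopy:
    they all start and end at [p 0]. *)
Lemma lasso_homotopic (A : set T) (p : R -> T) (turn : R -> R -> T) (a b : R) :
  0 <= a -> a <= b -> b <= 1 -> path_continuous p ->
  (forall s, s \in `[0, b] -> A (p s)) ->
  {within `[a, b] `*` I, continuous (fun st => turn st.1 st.2)} ->
  (forall s t, s \in `[a, b] -> t \in `[0, 1] -> A (turn s t)) ->
  (forall s, s \in `[a, b] -> turn s 0 = p s /\ turn s 1 = p s) ->
  path_homotopic A (lasso p turn a) (lasso p turn b).
Proof.
move=> a0 ab b1 cp pA cturn turnA turn01.
pose sig (u : R) := a + u * (b - a).
have sigI u : u \in `[0, 1] -> sig u \in `[a, b].
  rewrite !in_itv /= /sig => /andP[u0 u1].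
  have ba : 0 <= b - a by rewrite subr_ge0.
  by have := mulr_ge0 u0 ba; have := ler_piMl ba u1; lra.
have upto u t : u \in `[0, 1] -> t \in `[0, 1] -> sig u * t \in `[0, b].
  move=> /sigI; rewrite !in_itv /= => /andP[au ub] /andP[t0 t1].
  have u0 : 0 <= sig u := le_trans a0 au.
  by have := mulr_ge0 u0 t0; have := ler_piMr u0 t1; lra.
have uptoI u t : u \in `[0, 1] -> t \in `[0, 1] -> sig u * t \in `[0, 1].
  by move=> uI tI; have := upto _ _ uI tI; rewrite !in_itv /=; lra.
have revI (t : R) : t \in `[0, 1] -> 1 - t \in `[0, 1].
  by rewrite !in_itv /=; lra.
have csig : continuous (fun st : R * R => sig st.1).
  move=> st; apply: cvgD; first exact: cvg_cst.
  by apply: cvgM; [exact: cvg_fst|exact: cvg_cst].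
pose F (st : R * R) := p (sig st.1 * st.2).
pose G (st : R * R) := turn (sig st.1) st.2.
pose K (st : R * R) := p (sig st.1 * (1 - st.2)).
have cF : {within I `*` I, continuous F}.
  apply: within_continuous_comp_within _ cp _ => [|[u t] [/= uI tI]]; last exact: uptoI.
  apply: continuous_subspaceT => st; apply: cvgM; last exact: cvg_snd.
  exact: csig.
have cG : {within I `*` I, continuous G}.
  have := @within_continuous_comp_within _ _ _ (I `*` I) _
    (fun st : R * R => (sig st.1, st.2)) _ _ cturn.
  apply=> [|[u t] [/= /sigI]]; last by [].
  apply: continuous_subspaceT; apply: continuous_pair; first exact: csig.
  by move=> st; exact: cvg_snd.
have cK : {within I `*` I, continuous K}.
  apply: within_continuous_comp_within _ cp _ => [|[u t] [/= uI tI]]; last first.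
    by apply: uptoI => //; exact: revI.
  apply: continuous_subspaceT => st; apply: cvgM; first exact: csig.
  by apply: cvgB; [exact: cvg_cst|exact: cvg_snd].
exists (fun st => lasso p turn (sig st.1) st.2); split.
- apply: (path_cat_family (F := fun st => path_cat (path_upto p (sig st.1))
      (turn (sig st.1)) st.2) (G := K)) => //.
    apply: (path_cat_family (F := F) (G := G)) => // u /sigI /turn01[t0 _].
    by rewrite /F /G /= mulr1 t0.
  move=> u /sigI /turn01[_ t1].
  by rewrite /= path_cat1 t1 /K /= subr0 mulr1.
- move=> u t uI tI; apply: path_cat_in tI => t2 t2I.
    apply: path_cat_in t2I => t3 t3I; first by apply: pA; exact: upto.
    by apply: turnA => //; exact: sigI.
  by apply: pA; apply: upto => //; exact: revI.
- by move=> t _; rewrite /sig /= mul0r addr0 mul1r addrC subrK.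
by move=> u _; rewrite /lasso !path_cat0 !path_cat1 /path_rev /path_upto
  subrr !mulr0.
Qed.

End Lassos.

(** * Product coordinates *)

Section ProductCoordinates.
Variable R : realType.
Local Notation C := R[i].

Lemma pt1E (w : 'rV[C]_1) : pt1 (w 0 0) = w.
Proof. by apply/rowP => l; rewrite mxE ord1. Qed.

Lemma pt1_00 (c : C) : pt1 c 0 0 = c.
Proof. by rewrite mxE. Qed.

Lemma pt2_delta (x c : C) : pt2 x c = x *: delta_mx 0 0 + c *: delta_mx 0 1.
Proof.
apply/rowP => l; rewrite !mxE eqxx /=.
by case: l => [[|[|]]] //= ?; rewrite !(mulr0, mulr1, addr0, add0r).
Qed.

Lemma pt1_delta (c : C) : pt1 c = c *: const_mx 1.
Proof. by apply/rowP => l; rewrite !mxE mulr1. Qed.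

Lemma differentiable_pt1 (V : normedModType C) (f : V -> C) (v : V) :
  differentiable f v -> differentiable (fun v => pt1 (f v)) v.
Proof.
move=> df; under eq_fun do rewrite pt1_delta.
exact: differentiableZl.
Qed.

Lemma differentiable_pt2 (V : normedModType C) (f g : V -> C) (v : V) :
  differentiable f v -> differentiable g v ->
  differentiable (fun v => pt2 (f v) (g v)) v.
Proof.
move=> df dg; under eq_fun do rewrite pt2_delta.
by apply: differentiableD; exact: differentiableZl.
Qed.

Lemma continuous_pt1 : continuous (@pt1 R).
Proof.
move=> c; apply: (@differentiable_continuous _ _ _ c (@pt1 R)).
exact: (differentiable_pt1 (f := id)).
Qed.

Lemma continuous_pt2 (x : C) : continuous (pt2 x).
Proof.
move=> c; apply: (@differentiable_continuous _ _ _ c (pt2 x)).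
by apply: differentiable_pt2.
Qed.

Lemma nbhs_disc (c a e : C) : `|c - a| < e -> nbhs c [set v : C | `|v - a| < e].
Proof.
move=> ca; apply/nbhs_ballP; exists (e - `|c - a|); first by rewrite /= subr_gt0.
move=> v; rewrite /ball /= distrC => cv.
rewrite (_ : v - a = (v - c) + (c - a)); last by ring.
by apply: le_lt_trans (ler_normD _ _) _; rewrite -ltrBrDr.
Qed.

Section ProductChart.
Variables (S : set C) (H : set 'rV[C]_2) (x0 b eps rho : C).
Variables (U : set 'rV[C]_1) (phi psi : 'rV[C]_1 -> 'rV[C]_1).

Definition prod_dom : set 'rV[C]_2 := [set w |
  [/\ `|w 0 0 - x0| < eps, U (pt1 (w 0 1)) & `|phi (pt1 (w 0 1)) 0 0| < rho]].

Definition prod_chart (w : 'rV[C]_2) : 'rV[C]_2 :=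
  pt2 ((w 0 0 - x0) / eps) (phi (pt1 (w 0 1)) 0 0 / rho).

Definition prod_inv (w : 'rV[C]_2) : 'rV[C]_2 :=
  pt2 (x0 + eps * w 0 0) (psi (pt1 (rho * w 0 1)) 0 0).

(** The two factors are rescaled so that the product maps onto the whole unit
    polydisc; [rho <= 1] keeps [rho * w] in the polydisc, where [psi] inverts
    [phi]. *)
Lemma prod_straightening : 0 < eps -> 0 < rho -> rho <= 1 ->
  straightening (@pt1 R @` S) (pt1 b) U phi psi 0 ->
  (forall w, prod_dom w -> (H w <-> w 0 1 = b)) ->
  straightening H (pt2 x0 b) prod_dom prod_chart prod_inv 1.
Proof.
move=> eps_gt0 rho_gt0 rho_le1.
move=> [[oU Ub phib] [[phiP psiU phiK psiK] [dphi dpsi SU]]] Hdom.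
have nz_eps : eps != 0 by rewrite gt_eqF.
have nz_rho : rho != 0 by rewrite gt_eqF.
have pdisc (c : C) : `|c| < 1 -> polydisc (pt1 (rho * c)).
  move=> c1 l; rewrite mxE normrM (gtr0_norm rho_gt0).
  by rewrite (le_lt_trans _ c1) // ler_piMl.
have eps_ball (c : C) : (`|c / eps| < 1) = (`|c| < eps).
  by rewrite normrM normfV (gtr0_norm eps_gt0) ltr_pdivrMr // mul1r.
have rho_ball (c : C) : (`|c / rho| < 1) = (`|c| < rho).
  by rewrite normrM normfV (gtr0_norm rho_gt0) ltr_pdivrMr // mul1r.
have dphi1 (w : 'rV[C]_2) : U (pt1 (w 0 1)) ->
    differentiable (fun w : 'rV[C]_2 => phi (pt1 (w 0 1)) 0 0) w.
  move=> Uw.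
  apply: (@differentiable_comp _ _ _ _ (fun w : 'rV[C]_2 => phi (pt1 (w 0 1)))
    (fun v : 'rV[C]_1 => v 0 0)); last exact: differentiable_coord.
  apply: (@differentiable_comp _ _ _ _ (fun w : 'rV[C]_2 => pt1 (w 0 1)) phi).
    by apply: differentiable_pt1; exact: differentiable_coord.
  exact: dphi.
split; [split|split; [split|split]].
- rewrite openE => w [w0 w1 w2].
  have n0 : nbhs w [set v : 'rV[C]_2 | `|v 0 0 - x0| < eps].
    exact: (@coord_continuous C 1 2 0 0 w _ (nbhs_disc w0)).
  have n1 : nbhs w [set v : 'rV[C]_2 | U (pt1 (v 0 1))].
    have cw : {for w, continuous (fun v : 'rV[C]_2 => pt1 (v 0 1))}.
      apply: differentiable_continuous; apply: differentiable_pt1.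
      exact: differentiable_coord.
    by apply: (cw U); exact: open_nbhs_nbhs.
  have n2 : nbhs w [set v : 'rV[C]_2 | `|phi (pt1 (v 0 1)) 0 0 - 0| < rho].
    rewrite -[phi _ _ _]subr0 in w2.
    exact: (differentiable_continuous (dphi1 w w1) (nbhs_disc w2)).
  apply: filterS3 n0 n1 n2 => v /= v0 v1.
  by rewrite subr0.
- by rewrite /prod_dom /= pt2_0 pt2_1 subrr normr0 phib mxE normr0.
- rewrite /prod_chart pt2_0 pt2_1 subrr phib mxE !mul0r.
  by apply/rowP => l; rewrite !mxE if_same.
- move=> w [w0 _ w1] l; rewrite mxE; case: ifP => _.
    by rewrite eps_ball.
  by rewrite rho_ball.
- move=> w wP; rewrite /prod_dom /prod_inv /= pt2_0 pt2_1 pt1E.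
  have w1 := pdisc _ (wP 1); split; last 2 first.
  + exact: psiU.
  + by rewrite psiK // mxE normrM (gtr0_norm rho_gt0) -{2}(mulr1 rho) ltr_pM2l.
  by rewrite addrAC subrr add0r normrM (gtr0_norm eps_gt0) -{2}(mulr1 eps) ltr_pM2l.
- move=> w [w0 w1 w2]; rewrite /prod_inv /prod_chart pt2_0 pt2_1.
  rewrite [rho * _]mulrC divfK // pt1E phiK // pt1_00.
  by rewrite [eps * _]mulrC divfK // addrC subrK pt2E.
- move=> w wP; rewrite /prod_chart /prod_inv pt2_0 pt2_1 pt1E psiK; last first.
    exact: pdisc (wP 1).
  by rewrite addrAC subrr add0r pt1_00 ![_ * w _ _ / _]mulrAC !divff // !mul1r pt2E.
- move=> w [w0 w1 w2]; apply: differentiable_pt2.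
    apply: differentiableM => //.
    apply: differentiableB => //; exact: differentiable_coord.
  by apply: differentiableM => //; exact: dphi1.
- move=> w wP; apply: differentiable_pt2.
    apply: differentiableD => //; apply: differentiableM => //.
    exact: differentiable_coord.
  have w1 := pdisc _ (wP 1).
  apply: (@differentiable_comp _ _ _ _
    (fun w : 'rV[C]_2 => psi (pt1 (rho * w 0 1)))
    (fun v : 'rV[C]_1 => v 0 0)); last exact: differentiable_coord.
  apply: (@differentiable_comp _ _ _ _ (fun w : 'rV[C]_2 => pt1 (rho * w 0 1)) psi).
    apply: differentiable_pt1; apply: differentiableM => //.
    exact: differentiable_coord.
  exact: dpsi.
move=> w wD; have [w0 w1 w2] := wD; rewrite Hdom // pt2_1.
split=> [->|/eqP].
  by rewrite phib mxE mul0r.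
rewrite mulf_eq0 invr_eq0 (negPf nz_rho) orbF => /eqP phiw.
have : phi (pt1 (w 0 1)) = phi (pt1 b).
  by rewrite phib -[LHS]pt1E phiw; apply/rowP => l; rewrite !mxE.
move/(congr1 psi); rewrite !phiK // => /(congr1 (fun v : 'rV[C]_1 => v 0 0)).
by rewrite !pt1_00.
Qed.

End ProductChart.

End ProductCoordinates.

(** * Turns around a point of the line *)

Section Turns.
Variable R : realType.
Local Notation C := R[i].

Lemma continuous_unit_circle : continuous (@unit_circle R).
Proof.
have cC : continuous (fun u : R => u%:C : C).
  move=> u; apply/cvgrPdist_lt => e e0.
  have [Ree Ime] : 0 < complex.Re e /\ complex.Im e = 0.
    by move: e0; rewrite ltcE /= => /andP[/eqP-> ->].
  near=> v.
  have eE : e = (complex.Re e)%:C by rewrite [LHS]complexE Ime mulr0 addr0.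
  rewrite eE -rmorphB /= normc_def /= expr0n addr0 sqrtr_sqr ltcR; near: v.
  exact: cvgr_dist_lt.
have arg : continuous (fun t : R => 2 * pi * t).
  by move=> t; apply: cvgM => //; exact: cvg_cst.
have -> : @unit_circle R =
    (fun t => (cos (2 * pi * t))%:C + 'i%C * (sin (2 * pi * t))%:C).
  by apply/funext => t; rewrite /unit_circle [LHS]complexE.
move=> t.
apply: cvgD.
  apply: (@continuous_comp _ _ _ (fun t => cos (2 * pi * t)) (fun u => u%:C));
    last exact: cC.
  by apply: (@continuous_comp _ _ _ (fun t => 2 * pi * t) cos);
    [exact: arg|exact: continuous_cos].
apply: cvgM; first exact: cvg_cst.
apply: (@continuous_comp _ _ _ (fun t => sin (2 * pi * t)) (fun u => u%:C));
    last exact: cC.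
by apply: (@continuous_comp _ _ _ (fun t => 2 * pi * t) sin);
    [exact: arg|exact: continuous_sin].
Unshelve. all: by end_near.
Qed.

Lemma unit_circle01 : unit_circle 0 = 1 :> C /\ unit_circle 1 = 1 :> C.
Proof.
by rewrite /unit_circle !mulr0 mulr1 cos0 sin0 mulr_natl cos2pi sin2pi.
Qed.

Lemma norm_unit_circle (t : R) : `|unit_circle t : C| = 1.
Proof. by rewrite normc_def /= cos2Dsin2 sqrtr1. Qed.

Lemma positive_turn1E (phi psi : 'rV[C]_1 -> 'rV[C]_1) (w : 'rV[C]_1) t :
  positive_turn phi psi 0 w t = psi (pt1 (unit_circle t * phi w 0 0)).
Proof. by congr psi; apply/rowP => l; rewrite !mxE ord1. Qed.

(** The intermediate turns avoid [H], since in the coordinate [phi] they keep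
    the nonzero modulus of [phi (p u)]. *)
Lemma turn_lassos_homotopic (H U : set 'rV[C]_1) (b : 'rV[C]_1) phi psi
    (p : R -> 'rV[C]_1) (s s' : R) :
  straightening H b U phi psi 0 -> path_continuous p ->
  (forall t : R, t \in `[0, 1[ -> ~ H (p t)) ->
  0 <= s -> s <= s' -> s' < 1 ->
  (forall t : R, t \in `[s, 1] -> U (p t)) ->
  path_homotopic (~` H)
    (lasso p (fun u => positive_turn phi psi 0 (p u)) s)
    (lasso p (fun u => positive_turn phi psi 0 (p u)) s').
Proof.
move=> [[oU Ub phib] [[phiP psiU phiK psiK] [dphi dpsi HU]]] cp pH s0 ss' s'1 pU.
have pHs' u : u \in `[0, s'] -> ~ H (p u).
  by rewrite in_itv /= => /andP[u0 u1]; apply: pH; rewrite in_itv /=; lra.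
have pUs' u : u \in `[s, s'] -> U (p u).
  by rewrite in_itv /= => /andP[u0 u1]; apply: pU; rewrite in_itv /=; lra.
have turnP u t : u \in `[s, s'] ->
    polydisc (pt1 (unit_circle t * phi (p u) 0 0)).
  by move=> /pUs' Upu l; rewrite mxE normrM norm_unit_circle mul1r; exact: phiP.
apply: lasso_homotopic => //; first exact: ltW.
- apply: (@subspace_eq_continuous _ _ _
      (psi \o fun ut : R * R => pt1 (unit_circle ut.2 * phi (p ut.1) 0 0))).
    by move=> [u t] _; exact/esym/positive_turn1E.
  apply: within_continuous_comp.
    move=> _ /set_mem[[u t] [uI _] <-]; apply: differentiable_continuous.
    by apply: dpsi; apply: turnP; exact: uI.
  have cpair : {within `[s, s']%classic `*` `[0, 1]%classic, continuous
      (fun ut : R * R => (ut.2, p ut.1))}.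
    apply: within_continuous_pair.
      by apply: continuous_subspaceT => ut; exact: cvg_snd.
    apply: (@within_continuous_comp_within _ _ _ _ _ fst p _ cp).
      by apply: continuous_subspaceT => ut; exact: cvg_fst.
    by move=> [u t] [] /=; rewrite !in_itv /= => /andP[? ?] _; lra.
  apply: (@within_continuous_comp _ _ _ _ _
    (fun tv => pt1 (unit_circle tv.1 * phi tv.2 0 0)) _ cpair).
  move=> _ /set_mem[[u' t'] [/pUs' Upu _] <-]; move: (t') (p u') Upu => t v Uv.
  apply: (@continuous_comp _ _ _
    (fun tv : R * 'rV[C]_1 => unit_circle tv.1 * phi tv.2 0 0)
    (@pt1 R)); last exact: continuous_pt1.
  apply: cvgM.
    apply: (@continuous_comp _ _ _ fst (@unit_circle R)); first exact: cvg_fst.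
    exact: continuous_unit_circle.
  apply: (@continuous_comp _ _ _ (fun tv : R * 'rV[C]_1 => phi tv.2)
    (fun w : 'rV[C]_1 => w 0 0)); last exact: coord_continuous.
  apply: (@continuous_comp _ _ _ snd phi); first exact: cvg_snd.
  by apply: differentiable_continuous; exact: dphi.
- move=> u t uI tI; rewrite positive_turn1E => Hturn.
  have uP := turnP u t uI; have /HU[/(_ Hturn)+ _] := psiU _ uP.
  rewrite psiK // pt1_00 => /eqP; rewrite mulf_eq0 -normr_eq0 norm_unit_circle.
  rewrite oner_eq0 /= => /eqP phi0; apply: (pHs' u).
    by move: uI; rewrite !in_itv /=; lra.
  by apply/HU => //; exact: pUs'.
move=> u /pUs' Upu; have [u0 u1] := unit_circle01.
by rewrite !positive_turn1E u0 u1 mul1r pt1E phiK.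
Qed.

End Turns.

(** * Meridians in a vertical line *)

Section VerticalMeridian.
Variable R : realType.
Local Notation C := R[i].

Lemma continuous_eval2 (q : {poly {poly C}}) :
  continuous (fun w : 'rV[C]_2 => q.[w 0 0, w 0 1]).
Proof.
have cX k : continuous (fun w : 'rV[C]_2 => w 0 k) by exact: coord_continuous.
have c1 (p : {poly C}) : continuous (fun w : 'rV[C]_2 => p.[w 0 1]).
  elim/poly_ind: p => [|p c IHp].
    rewrite (_ : (fun w => _) = cst 0); first exact: cst_continuous.
    by apply/funext => w; rewrite horner0.
  rewrite (_ : (fun w => _) = (fun w : 'rV[C]_2 => p.[w 0 1] * w 0 1 + c)).
    by move=> w; exact: (cvgD (cvgM (IHp w) (cX 1 w)) (cvg_cst c)).
  by apply/funext => w; rewrite hornerMXaddC.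
elim/poly_ind: q => [|q p IHq].
  rewrite (_ : (fun w => _) = cst 0); first exact: cst_continuous.
  by apply/funext => w; rewrite !horner0.
rewrite (_ : (fun w => _) =
  (fun w : 'rV[C]_2 => q.[w 0 0, w 0 1] * w 0 0 + p.[w 0 1])).
  by move=> w; exact: (cvgD (cvgM (IHq w) (cX 0 w)) (c1 p w)).
by apply/funext => w; rewrite hornerMXaddC hornerD hornerM hornerC.
Qed.

(** By continuity of [psi] at the centre, a small value of [phi] forces the
    point to be close to [b], where [q] does not vanish. *)
Lemma product_chart_domain (q : {poly {poly C}}) (b x0 : C)
    (U : set 'rV[C]_1) (phi psi : 'rV[C]_1 -> 'rV[C]_1) (S : set C) :
  straightening (@pt1 R @` S) (pt1 b) U phi psi 0 -> q.[x0, b] != 0 ->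
  exists eps rho : C, [/\ 0 < eps, 0 < rho, rho <= 1 &
    forall w, prod_dom x0 eps rho U phi w -> q.[w 0 0, w 0 1] != 0].
Proof.
move=> [[oU Ub phib] [[phiP psiU phiK psiK] [dphi dpsi _]]] qx0.
have P0 : polydisc (0 : 'rV[C]_1) by move=> l; rewrite mxE normr0.
have psi0 : psi 0 = pt1 b by rewrite -phib phiK.
have : nbhs (pt2 x0 b) [set w : 'rV[C]_2 | q.[w 0 0, w 0 1] != 0].
  apply: (@continuous_eval2 q (pt2 x0 b) [set c : C | c != 0]).
  rewrite pt2_0 pt2_1; apply/nbhs_ballP; exists `|q.[x0, b]|.
    by rewrite /= normr_gt0.
  by move=> c; rewrite /ball /= => qc; apply: contraTneq qc => ->; rewrite subr0 ltxx.
move=> /nbhs_ballP[eps /= eps_gt0 near_q].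
have cpsi w : polydisc w -> \forall v \near w, ball (psi w) eps (psi v).
  move=> /dpsi/differentiable_continuous cpsi.
  exact: (cvg_ball cpsi eps_gt0).
have [delta /= delta_gt0 near_psi] := (nbhs_ballP _ _).1 (cpsi _ P0).
rewrite psi0 in near_psi.
(* A positive number below both 1 and delta. *)
exists eps, (delta / (1 + delta)).
have delta1 : 0 < 1 + delta by rewrite addr_gt0.
split=> //; first by rewrite divr_gt0.
  by rewrite ler_pdivrMr // mul1r lerDr.
move=> w [w0 Uw w1]; apply: near_q; split=> // i l; rewrite (ord1 i).
rewrite -ball_normE /= mxE; case: eqP => [->|/eqP l0]; first by rewrite distrC.
have -> : l = 1 by apply/val_inj; case: l l0 => [[|[|]]].
have : ball (0 : 'rV[C]_1) delta (phi (pt1 (w 0 1))).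
  split=> // j m; rewrite !ord1 -ball_normE /= mxE sub0r normrN.
  apply: lt_le_trans w1 _; rewrite ler_pdivrMr // mulrDr mulr1 lerDl.
  by rewrite mulr_ge0 // ltW.
move=> /near_psi; rewrite phiK // => -[_ /(_ 0 0)].
by rewrite -ball_normE /= !pt1_00.
Qed.

Lemma path_eventually_in (T : topologicalType) (p : R -> T) (W : set T) (s : R) :
  path_continuous p -> nbhs (p 1) W -> s \in `[0, 1[ ->
  exists s', [/\ s <= s', s' < 1 & forall t, t \in `[s', 1] -> W (p t)].
Proof.
move=> /subspace_continuousP cp pW; rewrite in_itv /= => /andP[s0 s1].
have I1 : `[0, 1]%classic (1 : R) by rewrite /= in_itv /=; lra.
have /nbhs_ballP[e /= e0 near_p] := cp 1 I1 _ pW.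
exists (Num.max s (1 - e / 2)); split.
- by rewrite le_max lexx.
- by rewrite gt_max s1 /=; lra.
move=> t; rewrite in_itv /= ge_max => /andP[/andP[st et] t1].
apply: near_p; last by rewrite /= in_itv /=; lra.
by rewrite /ball /= ger0_norm; lra.
Qed.

(** The meridian in the line turns in the coordinate [phi] at time [s]; the one
    in the plane turns in the product coordinates at a later time [s'], when
    the path has entered their domain. *)
Lemma meridian_vertical (S : set C) (q : {poly {poly C}}) (b x0 y0 : C)
    (g : R -> C) :
  let H := [set z : 'rV[C]_2 | q.[z 0 0, z 0 1] * (z 0 1 - b) = 0] in
  S = [set c | q.[x0, c] * (c - b) = 0] -> q.[x0, b] != 0 ->
  is_meridian (@pt1 R @` S) [set pt1 b] (pt1 y0) (fun t => pt1 (g t)) ->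
  is_meridian H (hline b) (pt2 x0 y0) (fun t => pt2 x0 (g t)).
Proof.
move=> H SE qx0 [_ nSy0 [cg g0 g1 gS] [z [p [_ [[_ Dz] _] [cp p0 p1 pS]]]]].
move=> [U [phi [psi [k [s [st sI pU hom]]]]]].
(* The only component [set pt1 b] through z forces z = b. *)
have zE : z = pt1 b by [].
rewrite zE ord1 in st p1 hom *.
pose slice (v : 'rV[C]_1) : 'rV[C]_2 := pt2 x0 (v 0 0).
have cslice : continuous slice.
  move=> v; apply: (@continuous_comp _ _ _ (fun v : 'rV[C]_1 => v 0 0) (pt2 x0)).
    exact: coord_continuous.
  exact: continuous_pt2.
have sliceH v : (~` (@pt1 R @` S)) v -> (~` H) (slice v).
  apply: contra_not; rewrite /H /slice /= pt2_0 pt2_1 => Hv.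
  by exists (v 0 0); rewrite ?pt1E // SE.
have slice_pt1 c : slice (pt1 c) = pt2 x0 c by rewrite /slice pt1_00.
have slice_path (f : R -> 'rV[C]_1) :
    path_continuous f -> path_continuous (slice \o f).
  by move=> cf; apply: within_continuous_comp cf => v _; exact: cslice.
have gE : (fun t => pt2 x0 (g t)) = slice \o (fun t => pt1 (g t)).
  by apply/funext => t; rewrite /= slice_pt1.
split.
- exists (mpoly2 (q * ('Y - b%:P%:P))).
    move=> f0; apply: (sliceH _ nSy0); rewrite slice_pt1 /H /= pt2_0 pt2_1.
    have := congr1 (fun f => eval_at f (pt2 x0 y0)) f0.
    rewrite /= eval_mpoly2 pt2_0 pt2_1 !hornerM horner2_XsubC => ->.
    by rewrite /eval_at meval0.
  rewrite zero_locus_mpoly2; apply/seteqP; split=> w;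
    by rewrite /H /= !hornerM horner2_XsubC.
- by rewrite -slice_pt1; exact: (sliceH _ nSy0).
- rewrite gE; split=> [|||t tI]; first exact: slice_path.
  + by rewrite /= g0 slice_pt1.
  + by rewrite /= g1 slice_pt1.
  exact: (sliceH _ (gS t tI)).
have [eps [rho [eps_gt0 rho_gt0 rho_le1 qdom]]] := product_chart_domain st qx0.
have st2 : straightening H (pt2 x0 b) (prod_dom x0 eps rho U phi)
    (prod_chart x0 eps rho phi) (prod_inv x0 eps rho psi) 1.
  apply: prod_straightening st _ => // w /qdom qw; rewrite /H /=.
  split=> [/eqP|->]; last by rewrite subrr mulr0.
  by rewrite mulf_eq0 (negPf qw) subr_eq0 => /eqP.
have [[oU2 Ub2 _] _] := st2.
have [s' [ss' s'1 ps']] : exists s', [/\ s <= s', s' < 1 &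
    forall t, t \in `[s', 1] -> prod_dom x0 eps rho U phi (slice (p t))].
  apply: path_eventually_in sI => //; first exact: slice_path.
  by apply: open_nbhs_nbhs; split=> //=; rewrite p1 slice_pt1.
move: sI; rewrite in_itv /= => /andP[s0 s1].
exists (pt2 x0 b), (slice \o p); split.
- exact: smooth_point_simple_root.
- exact: component_of_simple_root.
- split=> [|||t tI]; first exact: slice_path.
  + by rewrite /= p0 slice_pt1.
  + by rewrite /= p1 slice_pt1.
  exact: (sliceH _ (pS t tI)).
exists (prod_dom x0 eps rho U phi), (prod_chart x0 eps rho phi),
  (prod_inv x0 eps rho psi), 1, s'; split=> //.
  by rewrite in_itv /=; lra.
(* The image of a turn for phi is a turn for the product chart: the rescaling
   by rho cancels, and the first coordinate stays at its centre x0. *)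
have := path_homotopic_image cslice sliceH (path_homotopic_trans hom
  (turn_lassos_homotopic st cp pS s0 ss' s'1 pU)).
rewrite gE; congr path_homotopic; apply/funext => t.
rewrite /lasso /path_cat /path_rev /path_upto /=.
case: ifP => _ //; case: ifP => _ //.
rewrite positive_turn1E /slice /positive_turn /prod_inv /prod_chart !mxE /=.
rewrite subrr mul0r mulr0 addr0; congr (pt2 _ (psi (pt1 _) _ _)).
by rewrite pt1E [RHS]mulrC -!mulrA mulVf ?mulr1 // gt_eqF.
Qed.

End VerticalMeridian.

Theorem lemma5 (R : realType) (P : {poly {poly R[i]}}) (d : nat)
    (hd : (1 <= d)%N) (hPd : size P = d.+1) (hP : squarefree P)
    (r : nat) (y : 'I_r -> R[i]) (y_inj : injective y)
    (hy : forall c : R[i], root (discriminant P) c <-> exists j, y j = c)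
    (J : {set 'I_r})
    (hJ : forall j, j \in J <-> ~ (hline (y j) `<=` plane_curve P))
    (Q : {poly {poly R[i]}})
    (hQ : Q = P * \prod_(j in J) ('Y - (y j)%:P%:P))
    (x0 : R[i]) (hx0 : ~ root (discriminant (swapXY Q)) x0)
    (S : set R[i]) (hS : S = [set c | Q.[x0, c] = 0]) :
  (forall j, S (y j)) /\
  forall (y0 : R[i]) (gamma : 'I_r -> R -> R[i]),
    ~ S y0 ->
    (forall j, is_meridian (@pt1 R @` S) [set pt1 (y j)] (pt1 y0)
                 (fun t => pt1 (gamma j t))) ->
    forall j, is_meridian (plane_curve P `|` \bigcup_k hline (y k))
                (hline (y j)) (pt2 x0 y0) (fun t => pt2 x0 (gamma j t)).
Proof.
have QE x c : Q.[x, c] = P.[x, c] * \prod_(j in J) (c - y j).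
  rewrite hQ !hornerM !horner_prod; congr (_ * _).
  by apply: eq_bigr => j _; rewrite horner2_XsubC.
have Qy j x : Q.[x, y j] = 0.
  have [jJ|jJ] := boolP (j \in J).
    by rewrite QE (bigD1 j) //= subrr mul0r mulr0.
  have /contrapT/(_ (pt2 x (y j))) : ~ ~ (hline (y j) `<=` plane_curve P).
    by move/hJ; rewrite (negPf jJ).
  by rewrite /hline /plane_curve /= pt2_0 pt2_1 QE => -> //; rewrite mul0r.
split=> [j|y0 gamma nSy0 meridian_gamma j]; first by rewrite hS /= Qy.
have [q qE] := line_factor (Qy j).
pose q1 := swapXY q.
have Qq x c : Q.[x, c] = q1.[x, c] * (c - y j).
  rewrite -horner2_swapXY qE hornerM hornerM hornerXsubC.
  by rewrite -horner2_swapXY !hornerE.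
have -> : plane_curve P `|` \bigcup_k hline (y k) =
    [set z | q1.[z 0 0, z 0 1] * (z 0 1 - y j) = 0].
  apply/seteqP; split=> z /=; rewrite -Qq.
    by case=> [Pz|[k _ zk]]; [rewrite QE Pz mul0r|rewrite (zk : z 0 1 = y k)].
  rewrite QE => /eqP; rewrite mulf_eq0 => /orP[/eqP Pz|]; first by left.
  by case/prodf_eq0 => k _; rewrite subr_eq0 => /eqP zk; right; exists k.
apply: (@meridian_vertical _ S) => //.
  by rewrite hS; apply/seteqP; split=> c /=; rewrite Qq.
rewrite /q1 horner2_swapXY; apply: (discriminant_simple_root _ qE hx0).
(* Otherwise Q would not depend on Y; vanishing at y j, it would also vanish
   at (x0, y0). *)
rewrite ltnNge; apply/negP => /size1_polyC Qc; apply: nSy0.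
have := Qy j x0; rewrite hS /= -(horner2_swapXY Q) Qc hornerC => Qx0.
by rewrite -horner2_swapXY Qc hornerC.
Qed.
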